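(* (i) Let $X=[0,\infty)$ with the usual Lebesgue measure, let $1\le a<b\le\infty$ and let $\psi\in\Psi(a,b)$. Then the indices of the space $G(\psi;a,b)$ are $$\gamma_1(G(\psi;a,b))=\frac1b,\qquad \gamma_2(G(\psi;a,b))=\frac1a .$$ (ii) If $(X,\Sigma,\mu)$ is an arbitrary measure space with $\mu$ non-trivial, $\sigma$-finite and diffuse, $1\le a<b\le\infty$, and $\psi$ is an admissible weight on $(a,b)$, then $$\gamma^{(1)}(G(\psi;a,b))=\gamma^{(2)}(G(\psi;a,b))=2^{1/b}.$$ Here $1/\infty=0$.
   Context: Let $(X,\Sigma,\mu)$ be a measure space with non-trivial $\sigma$-finite measure. The measure $\mu$ is called diffuse if for every $A\in\Sigma$ with $\mu(A)\in(0,\infty)$ there exists a measurable $B\subset A$ with $\mu(B)=\mu(A)/2$. For $1\le a<b\le\infty$, an admissible weight on $(a,b)$ is a continuous, positive, log-convex function $\psi:(a,b)\to(0,\infty)$ such that the limits $\psi(a+0)$ and $\psi(b-0)$ exist (possibly $+\infty$), $\max(\psi(a+0),\psi(b-0))=\infty$ and $\min(\psi(a+0),\psi(b-0))>0$. For a positive function $\psi$ on $(a,b)$, the space $G(\psi;a,b)=G_X(\psi;a,b)$ consists of all measurable $h:X\to\mathbb{R}$ (modulo a.e. equality) with finite norm $\|h\|_{G(\psi;a,b)}=\sup_{p\in(a,b)}|h|_p/\psi(p)$, where $|h|_p=\left(\int_X|h(x)|^p\,\mu(dx)\right)^{1/p}$. $\Psi(a,b)$ is the set of all positive continuous functions $\psi$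 on the open interval $(a,b)$ for which there exists a measurable function $f:X\to\mathbb{R}$ with $f\in\bigcap_{p\in(a,b)}L_p(X)$ and $\psi(p)=|f|_p$ for all $p\in(a,b)$. For $X=[0,\infty)$ and a space $G=G(\psi;a,b)$ on $X$, define for $s>0$ the dilation operator $\sigma_sf(x)=f(x/s)$, with operator norm $\|\sigma_s\|=\|\sigma_s\|_{G\to G}$, and $$\gamma_1(G)=\lim_{s\to0+}\frac{\log\|\sigma_s\|}{\log s},\qquad \gamma_2(G)=\lim_{s\to\infty}\frac{\log\|\sigma_s\|}{\log s}.$$ For general $(X,\Sigma,\mu)$ and $G=G(\psi;a,b)$, the fundamental function is $\phi(G;\delta)=\sup\{\|I(A)\|_G:\ A\in\Sigma,\ \mu(A)\le\delta\}$ for $\delta\in(0,\infty)$, where $I(A)$ is the indicator function of $A$, and $$\gamma^{(2)}(G)=\limsup_{s\to0+}\frac{\phi(G;2s)}{\phi(G;s)},\qquad \gamma^{(1)}(G)=\liminf_{s\to0+}\frac{\phi(G;2s)}{\phi(G;s)}.$$ *)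

(* Defs.v *)
(* MathComp-Analysis *)
From HB Require Import structures.
From mathcomp Require Import all_boot all_order all_algebra.
From mathcomp Require Import all_classical all_reals all_analysis.

Set Implicit Arguments.
Unset Strict Implicit.
Unset Printing Implicit Defensive.

Import Order.TTheory GRing.Theory Num.Theory.
Import numFieldNormedType.Exports.

Local Open Scope classical_set_scope.
Local Open Scope ring_scope.
Local Open Scope ereal_scope.

Section measure_spaces.
Context d (X : measurableType d) (R : realType).
Variable mu : {measure set X -> \bar R}.

Definition nontrivial_measure := 0 < mu setT.

Definition diffuse := forall A : set X, measurable A -> 0 < mu A < +oo ->
  exists B : set X, [/\ measurable B, B `<=` A & mu B = mu A / 2%:E].

End measure_spaces.

Section weights.
Variable R : realType.
Implicit Types (a : R) (b : \bar R) (psi : R -> R).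

Definition exponents a b : set R := [set p | a%:E < p%:E < b].

(* The filter "p tends to b from below"; the case b = -oo never occurs, since
   b is always greater than some real number. *)
Definition left_of b : set_system R :=
  match b with
  | r%:E => r^'-
  | +oo => pinfty_nbhs R
  | -oo => ninfty_nbhs R
  end.

Definition admissible_weight a b psi :=
  [/\ {in exponents a b, forall p, (0 < psi p)%R},
      {in exponents a b, continuous psi},
      convex_function (exponents a b) (fun p => ln (psi p)) &
      exists la lb : \bar R,
        [/\ (psi p)%:E @[p --> a^'+] --> la,
            (psi p)%:E @[p --> left_of b] --> lb,
            Order.max la lb = +oo & 0 < Order.min la lb]].

End weights.

Section grand_Lebesgue_spaces.
Context d (X : measurableType d) (R : realType).
Variable mu : {measure set X -> \bar R}.
Implicit Types (a : R) (b : \bar R) (psi : R -> R) (h : X -> R).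

(* Elements of the space are represented by functions; the norm, and everything
   defined from it, is invariant under almost everywhere equality. *)
Definition Gnorm psi a b h : \bar R :=
  ereal_sup [set 'N[mu]_p%:E [EFin \o h] / (psi p)%:E | p in exponents a b].

Definition Gspace psi a b : set (X -> R) :=
  [set h | measurable_fun setT h /\ Gnorm psi a b h < +oo].

(* For linear T this is +oo exactly when T is unbounded, in particular when T h
   has infinite norm for some h in the space. *)
Definition Gopnorm psi a b (T : (X -> R) -> (X -> R)) : \bar R :=
  ereal_sup [set Gnorm psi a b (T h) |
             h in Gspace psi a b `&` [set h | Gnorm psi a b h <= 1]].

Definition Psi a b : set (R -> R) :=
  [set psi : R -> R | [/\ {in exponents a b, forall p, (0 < psi p)%R},
      {in exponents a b, continuous psi} &
      exists f : {mfun X >-> R}, forall p, exponents a b p ->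
        (f : X -> R) \in Lfun mu p%:E /\
        (psi p)%:E = 'N[mu]_p%:E [EFin \o f]]].

Definition fundamental_function psi a b (delta : R) : \bar R :=
  ereal_sup [set Gnorm psi a b \1_A |
             A in [set A : set X | measurable A /\ mu A <= delta%:E]].

Definition doubling_ratio psi a b (s : R) : \bar R :=
  fundamental_function psi a b (2 * s)%R / fundamental_function psi a b s.

Definition fundamental_index1 psi a b : \bar R :=
  limf_einf (doubling_ratio psi a b) 0^'+.

Definition fundamental_index2 psi a b : \bar R :=
  limf_esup (doubling_ratio psi a b) 0^'+.

End grand_Lebesgue_spaces.

(* The measure space [0, +oo[: the nonnegative reals with the trace of the
   Borel sigma-algebra of R and the trace of the Lebesgue measure. *)
Section half_line.
Variable R : realType.

Definition nonneg_reals : Type := {x : R | (0 <= x)%R}.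

HB.instance Definition _ := Choice.on nonneg_reals.
HB.instance Definition _ := isPointed.Build nonneg_reals
  (exist _ 0%R (lexx 0%R)).

Definition halfline_val (x : nonneg_reals) : measurableTypeR R := sval x.

Definition halfline : Type := g_sigma_algebra_preimageType halfline_val.

HB.instance Definition _ := Measurable.on halfline.

Definition halfline_lebesgue (A : set halfline) : \bar R :=
  lebesgue_measure (halfline_val @` A).

Let halfline_val_inj : injective halfline_val.
Proof. by move=> x y; exact: val_inj. Qed.

Let measurable_halfline_val (A : set halfline) :
  measurable A -> measurable (halfline_val @` A).
Proof.
move=> [B mB <-]; rewrite setTI.
suff -> : halfline_val @` (halfline_val @^-1` B) = B `&` `[0%R, +oo[%classic.
  by apply: measurableI => //; exact: measurable_itv.
apply/seteqP; split => [_ [[x x0] Bx <-]|x [Bx]].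
  by split => //; rewrite /= in_itv/= andbT.
by rewrite /= in_itv/= andbT => x0; exists (exist _ x x0).
Qed.

Let halfline_lebesgue0 : halfline_lebesgue set0 = 0.
Proof. by rewrite /halfline_lebesgue image_set0 measure0. Qed.

Let halfline_lebesgue_ge0 A : 0 <= halfline_lebesgue A.
Proof. exact: measure_ge0. Qed.

Let halfline_lebesgue_sigma_additive : semi_sigma_additive halfline_lebesgue.
Proof.
move=> F mF tF mUF; rewrite /halfline_lebesgue image_bigcup.
apply: measure_semi_sigma_additive => [i|//|].
- exact: measurable_halfline_val.
- apply/trivIsetP => i j _ _ ij; move/trivIsetP : tF => /(_ i j Logic.I Logic.I ij).
  move=> Fij; rewrite -subset0 => _ [[x Fix <-] [y Fjy]] /halfline_val_inj yx.
  have : (F i `&` F j) x by split => //; rewrite -yx.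
  by rewrite Fij.
- by rewrite -image_bigcup; exact: measurable_halfline_val.
Qed.

HB.instance Definition _ := isMeasure.Build _ _ _ halfline_lebesgue
  halfline_lebesgue0 halfline_lebesgue_ge0 halfline_lebesgue_sigma_additive.

End half_line.

Section dilation_indices.
Variable R : realType.

(* sigma_s f (x) = f (x / s). Only s > 0 is meaningful; the absolute value,
   which is then inert, makes the argument nonnegative for every real s. *)
Definition dilation (s : R) (f : halfline R -> R) : halfline R -> R :=
  fun x => f (exist _ `|halfline_val x / s|%R (normr_ge0 _)).

Definition dilation_exponent (psi : R -> R) (a : R) (b : \bar R) (s : R)
    : \bar R :=
  lne (Gopnorm (@halfline_lebesgue R) psi a b (dilation s)) / (ln s)%:E.

(* lim is a junk value when the limit does not exist, so statements about the
   indices must also assert convergence. *)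
Definition dilation_index1 psi a b : \bar R :=
  lim (dilation_exponent psi a b s @[s --> 0^'+]).

Definition dilation_index2 psi a b : \bar R :=
  lim (dilation_exponent psi a b s @[s --> +oo%R]).

End dilation_indices.

(* Main.v *)
Require Import Defs.
From mathcomp Require Import all_boot all_order all_algebra.
From mathcomp Require Import all_classical all_reals all_analysis.
From mathcomp Require Import measurable_realfun ring lra.

Set Implicit Arguments.
Unset Strict Implicit.
Unset Printing Implicit Defensive.

Import Order.TTheory GRing.Theory Num.Theory.
Import numFieldNormedType.Exports.

Local Open Scope classical_set_scope.
Local Open Scope ring_scope.
Local Open Scope ereal_scope.

(** Everything reduces to the behaviour of the powers s^(1/p) when p runs over
the interval (a, b), that is when 1/p runs over (1/b, 1/a).

Dilations. The substitution x = s y gives |sigma_s h|_p = s^(1/p) |h|_p for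
every p ([Lnorm_dilation]), so the norm of sigma_s on G(psi; a, b) is at most
the supremum of s^(1/p) over p. When psi(p) = |f|_p, the function f itself has
|f|_p / psi(p) = 1 for all p simultaneously, hence sigma_s f has norm exactly
that supremum ([Gopnorm_dilation]). The supremum is s^(1/b) for s < 1 and
s^(1/a) for s > 1: the quotient log ||sigma_s|| / log s is not only convergent
but constant on each side of 1.

Fundamental function. In a diffuse measure space, repeated halving of a set of
finite positive measure produces sets whose measures are as close as desired to
any small delta ([diffuse_approx]), hence, for small delta,
    phi(delta) = sup_p delta^(1/p) / psi(p)      ([fundamental_functionE]).
Since 2^(1/p) > 2^(1/b) for all p, phi(2 s) >= 2^(1/b) phi(s). Conversely, fix
p0 < q in (a, b). The weight psi is bounded below by some m > 0, because it is
continuous with positive limits at both ends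
([admissible_weight_lower_bound]). The terms of phi(2 s) with p < p0 are then
at most (2 s)^(1/p0) / m, and since s^(1/p0) = o(s^(1/q)) as s tends to 0, they
are negligible with respect to the term s^(1/q) / psi(q) of phi(s); the terms
with p >= p0 are at most 2^(1/p0) times the corresponding terms of phi(s). Hence
phi(2 s) <= L phi(s) for small s as soon as L > 2^(1/p0)
([weighted_power_sup_double_le]). Letting p0 tend to b, the doubling ratio
converges to 2^(1/b), and so do its lower and upper limits. *)

(** * Lower and upper limits along a filter *)

Section limits.
Context (T : choiceType) (X : filteredType T) (R : realType).
Implicit Types (f : X -> \bar R) (F : set_system X) (l : \bar R).

Lemma limf_esup_le f F l : Filter F ->
  (\forall x \near F, f x <= l) -> limf_esup f F <= l.
Proof.
move=> FF Fl; rewrite limf_esupE.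
apply: (@le_trans _ _ (ereal_sup (f @` [set x | f x <= l]))).
  by apply: ereal_inf_lbound; exists [set x | f x <= l].
by apply: ge_ereal_sup => _ [x fxl <-].
Qed.

Lemma limf_einf_ge f F l : Filter F ->
  (\forall x \near F, l <= f x) -> l <= limf_einf f F.
Proof.
move=> FF Fl; rewrite limf_einfE.
apply: (@le_trans _ _ (ereal_inf (f @` [set x | l <= f x]))).
  by apply: le_ereal_inf_tmp => _ [x fxl <-].
by apply: ereal_sup_ubound; exists [set x | l <= f x].
Qed.

Lemma limf_einf_le_esup f F : ProperFilter F -> limf_einf f F <= limf_esup f F.
Proof.
move=> FF; rewrite limf_einfE limf_esupE.
apply: ge_ereal_sup => _ [V FV <-]; apply: le_ereal_inf_tmp => _ [W FW <-].
have [x [Vx Wx]] : (V `&` W) !=set0 by exact: filter_ex (filterI FV FW).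
apply: (@le_trans _ _ (f x)).
  by apply: ereal_inf_lbound; exists x.
by apply: ereal_sup_ubound; exists x.
Qed.

End limits.

(** * Inverse exponents *)

Section exponents.
Context (R : realType) (a : R) (b : \bar R).
Hypotheses (a1 : (1 <= a)%R) (ab : a%:E < b).

Let a0 : (0 < a)%R. Proof. exact: lt_le_trans a1. Qed.

Lemma exponents_gt0 p : exponents a b p -> (0 < p)%R.
Proof. by move=> /andP[]; rewrite lte_fin => + _; exact: lt_trans. Qed.

Lemma exponents_invr_ge0 p : exponents a b p -> (0 <= p^-1)%R.
Proof. by move=> /exponents_gt0/ltW; rewrite invr_ge0. Qed.

Lemma exponents_invr_lt p : exponents a b p -> (p^-1 < a^-1)%R.
Proof.
move=> pab; have p0 := exponents_gt0 pab; move: pab => /andP[ap _].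
by rewrite ltf_pV2 ?posrE.
Qed.

Lemma exponents_invr_le1 p : exponents a b p -> (p^-1 <= 1)%R.
Proof.
by move=> /exponents_invr_lt/ltW/le_trans; apply; rewrite invf_le1.
Qed.

Lemma exponents_inve_fin : b^-1 \is a fin_num.
Proof.
case: b ab => [r|//|//]; rewrite lte_fin => /(lt_trans a0) r0.
by rewrite inver gt_eqF.
Qed.

Lemma exponents_inve_lt p : exponents a b p -> (fine b^-1 < p^-1)%R.
Proof.
move=> pab; have p0 := exponents_gt0 pab; move: pab => /andP[_].
case: b => [r||//].
- rewrite lte_fin => pr; have r0 := lt_trans p0 pr.
  by rewrite inver gt_eqF/= ?ltf_pV2 ?posrE.
- by move=> _; rewrite invey invr_gt0.
Qed.

(** Together with [exponents_inve_lt], this says that 1/b, read as 0 when b is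
infinite, is the infimum of the inverse exponents. *)
Lemma exponents_near_right (e : R) : (fine b^-1 < e)%R ->
  exists2 p, exponents a b p & (p^-1 < e)%R.
Proof.
move=> be; have e0 : (0 < e)%R.
  apply: le_lt_trans be; rewrite fine_ge0// inve_ge0; apply/ltW.
  by apply: lt_trans ab; rewrite lte_fin; have := a0; lra.
have [c [ac eb ce]] : exists c, [/\ (a < c)%R, c%:E < b & (e^-1 < c)%R].
  case: b ab be => [r||]//.
  - rewrite lte_fin => ar; rewrite inver gt_eqF/=; last by have := a0; lra.
    move=> re; have {}re : (e^-1 < r)%R.
      by rewrite -(invrK r) ltf_pV2 ?posrE ?invr_gt0//; have := a0; lra.
    exists ((Num.max a e^-1 + r) / 2)%R; rewrite lte_fin.
    by split; case: (leP a e^-1%R) => ?; lra.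
  - move=> _ _; exists (Num.max a e^-1 + 1)%R; rewrite ltry.
    by split => //; case: (leP a e^-1%R) => ?; lra.
exists c; first by apply/andP.
by rewrite -(invrK e) ltf_pV2 ?posrE ?invr_gt0//; have := a0; lra.
Qed.

Lemma exponents_near_left (e : R) : (e < a^-1)%R ->
  exists2 p, exponents a b p & (e < p^-1)%R.
Proof.
move=> ea; have a0' := a0.
(* e may be negative or zero, so it is first raised to a positive number *)
pose e' := Num.max e (a + 1)^-1%R.
have e'0 : (0 < e')%R by rewrite lt_max invr_gt0; apply/orP; right; lra.
have e'a : (a < e'^-1)%R.
  rewrite -(invrK a) ltf_pV2 ?posrE ?invr_gt0// gt_max ea/=.
  by rewrite ltf_pV2 ?posrE//; lra.
have [c [ac cb ce]] : exists c, [/\ (a < c)%R, c%:E < b & (c < e'^-1)%R].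
  case: b ab => [r||]//.
  - rewrite lte_fin => ar; exists ((a + Num.min r e'^-1) / 2)%R; rewrite lte_fin.
    by split; case: (leP r e'^-1%R) => ?; lra.
  - by exists ((a + e'^-1) / 2)%R; rewrite ltry; split => //; lra.
exists c; first by apply/andP.
apply: (@le_lt_trans _ _ e'); first by rewrite le_max lexx.
by rewrite -(invrK e') ltf_pV2 ?posrE ?invr_gt0//; lra.
Qed.

Lemma exponents_neq0 : exponents a b !=set0.
Proof.
have [|p pab _] := @exponents_near_left (a^-1 - 1)%R; first by lra.
by exists p.
Qed.

Lemma exponents_gt p : exponents a b p -> exists2 q, exponents a b q & (p < q)%R.
Proof.
move=> pab; have p0 := exponents_gt0 pab.
have [q qab qp] := exponents_near_right (exponents_inve_lt pab).
exists q => //; have q0 := exponents_gt0 qab.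
by move: qp; rewrite ltf_pV2 ?posrE.
Qed.

End exponents.

(** Since s^(ln r / ln s) = r, multiplying a power of s by a constant amounts to
shifting the exponent. This turns the approximation of the extreme exponents
into the approximation of the extreme powers. *)
Lemma powR_addlog (R : realType) (s c r : R) :
  (0 < s)%R -> (s != 1)%R -> (0 < r)%R ->
  (s `^ (c + ln r / ln s) = s `^ c * r)%R.
Proof.
move=> s0 s1 r0; rewrite powRD; last by apply/implyP => _; rewrite gt_eqF.
congr (_ * _)%R; rewrite /powR gt_eqF// divfK ?lnK//.
by rewrite ln_eq0.
Qed.

(** * Norms of dilations on the half-line *)

Section dilation.
Context (R : realType).

(** Uniqueness of Lebesgue measure: after division by s, the left-hand side is a
measure that agrees with the length on half-open intervals. *)
Lemma lebesgue_measure_preimage_div (s : R) (A : set (measurableTypeR R)) :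
  (0 < s)%R -> measurable A ->
  lebesgue_measure ((fun y => y / s)%R @^-1` A) = s%:E * lebesgue_measure A.
Proof.
move=> s0 mA; have s'0 : (0 <= s^-1)%R by rewrite invr_ge0 ltW.
pose h : measurableTypeR R -> measurableTypeR R := fun y => (y / s)%R.
have mh : measurable_fun setT h by exact: mulrr_measurable.
(* pushing forward along h yields a measure only because h is measurable: nu takes
   this fact as its argument *)
pose nu : {measure set (measurableTypeR R) -> \bar R} :=
  mscale (NngNum s'0) (pushforward lebesgue_measure h).
suff -> : lebesgue_measure A = nu mh A.
  by rewrite /nu/= /mscale/= muleA -EFinM divff ?mul1e// gt_eqF.
apply: (lebesgue_measure_unique (mu := nu mh)) => // _ /ocitvP[->|[[u v] /= uv ->]].
  by rewrite !measure0.
rewrite /nu/= /mscale/= /pushforward.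
have -> : h @^-1` `]u, v] = `](u * s)%R, (v * s)%R]%classic.
  apply/seteqP; split => y /=; by rewrite !in_itv/= /h ltr_pdivlMr// ler_pdivrMr.
rewrite !lebesgue_measure_itv/= !lte_fin uv ltr_pM2r// uv -!EFinB -EFinM.
by congr EFin; field; rewrite gt_eqF.
Qed.

Lemma halfline_val_ge0 (x : halfline R) : (0 <= halfline_val x)%R.
Proof. exact: (svalP x). Qed.

(** The point transformation underlying [dilation]: [dilation s f] is convertible
to [f \o halfline_scale s]. *)
Definition halfline_scale (s : R) (x : halfline R) : halfline R :=
  exist _ `|halfline_val x / s|%R (normr_ge0 _).

Lemma measurable_halfline_scale s : measurable_fun setT (halfline_scale s).
Proof.
move=> _ _ [B mB <-]; rewrite !setTI.
exists ((fun y : measurableTypeR R => `|y / s|%R) @^-1` B); last by rewrite setTI.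
rewrite -[X in measurable X]setTI.
have : measurable_fun setT (fun y : measurableTypeR R => `|y / s|%R).
  by apply: measurableT_comp => //; exact: mulrr_measurable.
by apply.
Qed.

Lemma measurable_halfline_image (A : set (halfline R)) : measurable A ->
  measurable (@halfline_val R @` A).
Proof.
move=> [B mB <-]; rewrite setTI.
suff -> : @halfline_val R @` (@halfline_val R @^-1` B) = B `&` `[0%R, +oo[%classic.
  by apply: measurableI => //; exact: measurable_itv.
apply/seteqP; split => [_ [[x x0] Bx <-]|x [Bx]].
  by split => //; rewrite /= in_itv/= andbT.
by rewrite /= in_itv/= andbT => x0; exists (exist _ x x0).
Qed.

Lemma halfline_lebesgue_scale (s : R) (A : set (halfline R)) :
  (0 < s)%R -> measurable A ->
  pushforward (@halfline_lebesgue R) (halfline_scale s) A =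
    s%:E * halfline_lebesgue A.
Proof.
move=> s0 mA; rewrite /pushforward /halfline_lebesgue.
rewrite -lebesgue_measure_preimage_div//; last exact: measurable_halfline_image.
congr (lebesgue_measure _); apply/seteqP; split => [_ [x Ax <-]|y [x Ax xy]] /=.
  exists (halfline_scale s x) => //=.
  by rewrite [LHS]ger0_norm// divr_ge0 ?halfline_val_ge0 ?ltW.
have y0 : (0 <= y)%R.
  by rewrite -(divfK (lt0r_neq0 s0) y) -xy mulr_ge0 ?(ltW s0) ?halfline_val_ge0.
exists (exist _ y y0) => //; rewrite /preimage/=.
suff -> : halfline_scale s (exist _ y y0) = x by [].
by apply: val_inj; rewrite /= /halfline_val/= ger0_norm ?divr_ge0 ?(ltW s0)//.
Qed.

(** Change of variable along x = s y, using that the image measure of the Lebesgue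
measure under division by s is s times the Lebesgue measure. *)
Lemma Lnorm_dilation (s p : R) (f : halfline R -> R) :
  (0 < s)%R -> (0 < p)%R -> measurable_fun setT f ->
  'N[@halfline_lebesgue R]_p%:E [EFin \o dilation s f] =
  (s `^ p^-1)%:E * 'N[@halfline_lebesgue R]_p%:E [EFin \o f].
Proof.
move=> s0 p0 mf; rewrite unlock.
pose g x := `|(f x)%:E| `^ p.
have mg : measurable_fun setT g.
  apply/(@measurableT_comp _ _ _ _ _ _ (@poweR R ^~ p)).
    exact: measurable_poweR.
  by apply: measurableT_comp => //; exact/measurable_EFinP.
have g0 x : 0 <= g x by exact: poweR_ge0.
rewrite -poweR_EFin -poweRM ?lee_fin ?(ltW s0)//; last first.
  by apply: integral_ge0 => x _; exact: g0.
congr (_ `^ _).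
transitivity (\int[@halfline_lebesgue R]_x (g \o halfline_scale s) x); first by [].
have <- := ge0_integral_pushforward (measurable_halfline_scale s)
  (@halfline_lebesgue R) measurableT mg (fun x _ => g0 x).
transitivity (\int[mscale (NngNum (ltW s0)) (@halfline_lebesgue R)]_x g x).
  apply: eq_measure_integral => [|? A mA _]; first exact: measurable_halfline_scale.
  exact: halfline_lebesgue_scale.
by rewrite ge0_integral_mscale.
Qed.

End dilation.

Section dilation_norm.
Context (R : realType) (a : R) (b : \bar R) (psi : R -> R).
Hypotheses (a1 : (1 <= a)%R) (ab : a%:E < b).
Hypothesis Psi_psi : Psi (@halfline_lebesgue R) a b psi.

(** The hypotheses say that s^e is the supremum of the powers s^(1/p); both
extreme exponents are treated this way. The lower bound is witnessed by the
function f that represents psi, for which all the quotients |f|_p / psi(p) are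
equal to 1. *)
Lemma Gopnorm_dilation (s e : R) : (0 < s)%R ->
  (forall p, exponents a b p -> s `^ p^-1 <= s `^ e)%R ->
  (forall r, (0 < r < 1)%R ->
     exists2 p, exponents a b p & (r * s `^ e <= s `^ p^-1)%R) ->
  Gopnorm (@halfline_lebesgue R) psi a b (dilation s) = (s `^ e)%:E.
Proof.
move=> s0 se_ge se_le; have [psi0 _ [f fpsi]] := Psi_psi.
have {}psi0 p : exponents a b p -> (0 < psi p)%R by move=> ?; rewrite psi0 ?inE.
have GdilE h p : measurable_fun setT h -> exponents a b p ->
    'N[@halfline_lebesgue R]_p%:E [EFin \o dilation s h] / (psi p)%:E =
    (s `^ p^-1)%:E * ('N[@halfline_lebesgue R]_p%:E [EFin \o h] / (psi p)%:E).
  by move=> mh pab; rewrite Lnorm_dilation ?(exponents_gt0 a1 pab)// muleA.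
have f1 p : exponents a b p ->
    'N[@halfline_lebesgue R]_p%:E [EFin \o f] / (psi p)%:E = 1.
  move=> pab; have [_ <-] := fpsi p pab; have p0 := psi0 p pab.
  by rewrite inver gt_eqF// -EFinM divff ?gt_eqF.
apply/eqP; rewrite eq_le; apply/andP; split.
- apply: ge_ereal_sup => _ [h [[mh _] h1] <-].
  apply: ge_ereal_sup => _ [p pab <-]; rewrite GdilE// -[leRHS]mule1.
  apply: lee_pmul; rewrite ?lee_fin ?powR_ge0 ?se_ge//.
    apply: mule_ge0; first exact: Lnorm_ge0.
    by rewrite inve_ge0 lee_fin ltW ?psi0.
  by apply: le_trans h1; apply: ereal_sup_ubound; exists p.
- apply/lee_mul01Pr => [|r r01]; first by rewrite lee_fin powR_ge0.
  have [p pab rp] := se_le r r01.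
  apply: (@le_trans _ _ (s `^ p^-1)%:E); first by rewrite -EFinM lee_fin.
  have f1le : Gnorm (@halfline_lebesgue R) psi a b f <= 1.
    by apply: ge_ereal_sup => _ [q qab <-]; rewrite f1.
  apply: (@le_trans _ _ (Gnorm (@halfline_lebesgue R) psi a b (dilation s f))).
    by apply: ereal_sup_ubound; exists p => //; rewrite GdilE// f1// mule1.
  apply: ereal_sup_ubound; exists (f : halfline R -> R) => //; split => //.
  by split => //=; apply: le_lt_trans f1le _; rewrite ltry.
Qed.

Lemma dilation_exponentE (s e : R) : (0 < s)%R -> (s != 1)%R ->
  Gopnorm (@halfline_lebesgue R) psi a b (dilation s) = (s `^ e)%:E ->
  dilation_exponent psi a b s = e%:E.
Proof.
move=> s0 s1 sE; have lns : ln s != 0%R by rewrite ln_eq0.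
by rewrite /dilation_exponent sE lne_EFin ?powR_gt0// ln_powR inver
  (negbTE lns) -EFinM mulfK.
Qed.

Lemma dilation_exponent_lt1 (s : R) : (0 < s < 1)%R ->
  dilation_exponent psi a b s = b^-1.
Proof.
move=> /andP[s0 s1]; rewrite -[RHS]fineK ?(exponents_inve_fin a1)//.
apply: dilation_exponentE => //; first by rewrite lt_eqF.
apply: Gopnorm_dilation => // [p pab|r /andP[r0 r1]].
- by rewrite ger_powR ?s0 ?ltW// (exponents_inve_lt a1).
- have [|p pab pe] := @exponents_near_right _ a b a1 ab (fine b^-1 + ln r / ln s)%R.
    by rewrite ltrDl nmulr_rgt0 ?invr_lt0 ?ln_lt0 ?r0 ?s0.
  exists p => //; rewrite mulrC -powR_addlog ?lt_eqF//.
  by rewrite ger_powR ?s0 ?ltW.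
Qed.

Lemma dilation_exponent_gt1 (s : R) : (1 < s)%R ->
  dilation_exponent psi a b s = (a^-1)%:E.
Proof.
move=> s1; have s0 : (0 < s)%R by exact: lt_trans s1.
apply: dilation_exponentE => //; first by rewrite gt_eqF.
apply: Gopnorm_dilation => // [p pab|r /andP[r0 r1]].
- by rewrite ler_powR ?ltW ?(exponents_invr_lt a1 pab).
- have [|p pab pe] := @exponents_near_left _ a b a1 ab (a^-1 + ln r / ln s)%R.
    by rewrite gtrDl pmulr_llt0 ?invr_gt0 ?ln_gt0// ln_lt0 ?r0.
  exists p => //; rewrite mulrC -powR_addlog ?gt_eqF//.
  by rewrite ler_powR ?ltW.
Qed.

End dilation_norm.

(** * Sets of prescribed measure *)

Section norms.
Context d (X : measurableType d) (R : realType).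
Variable mu : {measure set X -> \bar R}.

Lemma Lnorm_indic (A : set X) (p : R) : measurable A -> (0 < p)%R ->
  'N[mu]_p%:E [EFin \o \1_A] = mu A `^ p^-1.
Proof.
move=> mA p0; rewrite unlock; congr (_ `^ _).
rewrite -[A in RHS]setIT -integral_indic//; apply: eq_integral => x _ /=.
by rewrite indicE; case: (x \in A); rewrite ?normr1 ?normr0 ?powR1 ?powR0 ?gt_eqF.
Qed.

(** Dyadic expansion of t / m: at each step A is cut into two halves. If t is at
most half of the measure of A, the search continues inside one half; otherwise
one half is kept entirely and the search for the rest of t continues in the
other one. After n steps the error is at most m / 2^n. *)
Lemma diffuse_approx (A : set X) (m t : R) n : diffuse mu -> measurable A ->
  mu A = m%:E -> (0 < m)%R -> (0 <= t <= m)%R ->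
  exists B, [/\ measurable B, B `<=` A &
    (t - m / 2 ^+ n)%:E <= mu B <= t%:E].
Proof.
move=> dmu; elim: n A m t => [|n IH] A m t mA muA m0 /andP[t0 tm].
  exists set0; rewrite measure0 !lee_fin expr0 divr1 t0 andbT.
  by split => //; lra.
have [|B [mB BA muB]] := dmu A mA; first by rewrite muA lte_fin m0 ltry.
have {}muB : mu B = (m / 2)%:E by rewrite muB muA inver pnatr_eq0.
have m20 : (0 < m / 2)%R by lra.
have mE : (m / 2 ^+ n.+1 = m / 2 / 2 ^+ n)%R by rewrite exprS invfM mulrA.
have [tm2|tm2] := leP t (m / 2)%R.
  have [|C [mC CB muC]] := IH B _ t mB muB m20; first by rewrite t0.
  by exists C; split => //; [exact: subset_trans CB BA|rewrite mE].
have mAB : measurable (A `\` B) by exact: measurableD.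
have muAB : mu (A `\` B) = (m / 2)%:E.
  have -> : mu (A `\` B) = mu A - mu (A `&` B).
    have muAy : mu A < +oo by rewrite muA ltry.
    exact: measureD.
  by rewrite (setIidr BA) muB muA -EFinB; congr EFin; lra.
have [|C [mC CAB]] := IH _ _ (t - m / 2)%R mAB muAB m20.
  by apply/andP; split; lra.
move=> muC; exists (B `|` C); split.
- exact: measurableU.
- by rewrite subUset; split => //; apply: subset_trans CAB _; exact: subDsetl.
- have -> : mu (B `|` C) = mu B + mu C.
    by apply: measureU => //; rewrite -subset0 => x [Bx /CAB[_]].
  have shift x : (t - x)%:E = (m / 2)%:E + (t - m / 2 - x)%:E.
    by rewrite -EFinD; congr EFin; ring.
  have -> : t%:E = (m / 2)%:E + (t - m / 2)%:E.
    by rewrite -EFinD; congr EFin; ring.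
  by rewrite muB mE shift !leeD2lE.
Qed.

Lemma sigma_finite_nontrivial : nontrivial_measure mu -> sigma_finite setT mu ->
  exists (A : set X) (m : R), [/\ measurable A, (0 < m)%R & mu A = m%:E].
Proof.
move=> mu0 [F TF mF].
have [n Fn0] : exists n, 0 < mu (F n).
  apply/not_existsP => F0.
  have : mu.-negligible (\bigcup_n F n).
    apply: negligible_bigcup => n; have [mFn _] := mF n.
    exists (F n); split => //; apply/eqP; rewrite eq_le measure_ge0 andbT leNgt.
    exact/negP/F0.
  rewrite -TF => /(negligibleP mu measurableT) muT0.
  by move: mu0; rewrite /nontrivial_measure muT0 ltxx.
have [mFn Fnfin] := mF n.
exists (F n), (fine (mu (F n))); split => //.
- by rewrite fine_gt0// Fn0.
- by rewrite fineK// ge0_fin_numE.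
Qed.

End norms.

(** * The fundamental function *)

Section fundamental.
Context (R : realType) (a : R) (b : \bar R) (psi : R -> R).
Hypotheses (a1 : (1 <= a)%R) (ab : a%:E < b).
Hypothesis psi0 : forall p, exponents a b p -> (0 < psi p)%R.

(** The fundamental function of G(psi; a, b) at a point s where every measure
below s can be approximated. *)
Definition weighted_power_sup (s : R) : \bar R :=
  ereal_sup [set (s `^ p^-1 / psi p)%:E | p in exponents a b].

Lemma weighted_power_sup_ge s p : exponents a b p ->
  (s `^ p^-1 / psi p)%:E <= weighted_power_sup s.
Proof. by move=> pab; apply: ereal_sup_ubound; exists p. Qed.

Lemma weighted_power_sup_gt0 s : (0 < s)%R -> 0 < weighted_power_sup s.
Proof.
move=> s0; have [p pab] := exponents_neq0 a1 ab.
apply: lt_le_trans (weighted_power_sup_ge s pab).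
by rewrite lte_fin divr_gt0 ?powR_gt0 ?psi0.
Qed.

Lemma weighted_power_sup_lty (m s : R) : (0 < m)%R ->
  (forall p, exponents a b p -> m <= psi p)%R -> (0 <= s <= 1)%R ->
  weighted_power_sup s < +oo.
Proof.
move=> m0 mpsi /andP[s0 s1]; apply: (@le_lt_trans _ _ m^-1%:E); last exact: ltry.
apply: ge_ereal_sup => _ [p pab <-]; rewrite lee_fin -[leRHS]mul1r.
have p0 := exponents_invr_ge0 a1 pab.
apply: ler_pM; rewrite ?powR_ge0 ?invr_ge0 ?(ltW (psi0 pab))//.
- by have := ge0_ler_powR p0; move=> /(_ s 1%R); rewrite powR1 !nnegrE; exact.
- by rewrite lef_pV2 ?posrE ?mpsi ?psi0.
Qed.

(** The two suprema, over sets and over exponents, commute, and for each p the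
supremum over sets of mu(B)^(1/p) is s^(1/p), by approximation of s from below. *)
Lemma fundamental_functionE d (X : measurableType d)
    (mu : {measure set X -> \bar R}) (A : set X) (m s : R) :
  diffuse mu -> measurable A -> mu A = m%:E -> (0 < m)%R -> (0 < s <= m)%R ->
  fundamental_function mu psi a b s = weighted_power_sup s.
Proof.
move=> dmu mA muA m0 /andP[s0 sm].
have termE (B : set X) x p : measurable B -> mu B = x%:E -> exponents a b p ->
    'N[mu]_p%:E [EFin \o \1_B] / (psi p)%:E = (x `^ p^-1 / psi p)%:E.
  move=> mB muB pab; rewrite Lnorm_indic ?(exponents_gt0 a1 pab)// muB.
  by rewrite inver gt_eqF ?psi0.
have muE (B : set X) : mu B <= s%:E -> mu B = (fine (mu B))%:E.
  by move=> muB; rewrite fineK// ge0_fin_numE// (le_lt_trans muB) ?ltry.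
apply/eqP; rewrite eq_le; apply/andP; split.
- apply: ge_ereal_sup => _ [B [mB muB] <-]; apply: ge_ereal_sup => _ [p pab <-].
  rewrite (termE _ _ _ mB (muE _ muB) pab).
  apply: le_trans (weighted_power_sup_ge s pab).
  have p0 := exponents_invr_ge0 a1 pab; have ps0 := psi0 pab.
  rewrite lee_fin ler_pM2r ?invr_gt0// ge0_ler_powR ?nnegrE ?fine_ge0 ?(ltW s0)//.
  by rewrite -lee_fin -muE.
- apply: ge_ereal_sup => _ [p pab <-].
  have p0 := exponents_invr_ge0 a1 pab; have ps0 := psi0 pab.
  apply/lee_mul01Pr => [|r /andP[r0 r1]].
    by rewrite lee_fin divr_ge0 ?powR_ge0 ?ltW.
  (* halving A often enough yields a set of measure between r * s and s;
     the factor r is not spoiled by the root, since r <= r^(1/p) *)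
  pose e := ((1 - r) * s)%R; have e0 : (0 < e)%R by rewrite mulr_gt0 ?subr_gt0.
  pose n := Num.bound (m / e).
  have mn : (m / 2 ^+ n <= e)%R.
    rewrite ler_pdivrMr ?exprn_gt0// mulrC -ler_pdivrMr//.
    by apply/ltW/upper_nthrootP.
  have [|B [mB _ /andP[Bge Ble]]] := diffuse_approx n dmu mA muA m0 (t := s).
    by rewrite sm ltW.
  have rsB : (r * s <= fine (mu B))%R.
    rewrite -lee_fin -muE//; apply: le_trans Bge; rewrite lee_fin.
    by move: mn; rewrite /e; lra.
  apply: (@le_trans _ _ (Gnorm mu psi a b \1_B)); last first.
    by apply: ereal_sup_ubound; exists B.
  apply: (@le_trans _ _ ((fine (mu B)) `^ p^-1 / psi p)%:E); last first.
    by apply: ereal_sup_ubound; exists p; rewrite ?(termE _ _ _ mB (muE _ Ble)).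
  rewrite -EFinM lee_fin mulrA ler_pM2r ?invr_gt0//.
  apply: (@le_trans _ _ ((r * s) `^ p^-1)%R); last first.
    rewrite ge0_ler_powR ?nnegrE ?fine_ge0// mulr_ge0// ltW//.
  rewrite powRM ?(ltW r0) ?(ltW s0)// ler_pM2r ?powR_gt0//.
  by rewrite ger1_powR ?r0 ?(ltW r1) ?(exponents_invr_le1 a1 pab).
Qed.

(** The exponents p and q, with p < q, separate the interval: for small s the term
at q dominates the bound s^(1/p) / m common to all the terms below p, while
above p doubling s costs at most a factor 2^(1/p) < L. *)
Lemma weighted_power_sup_double_le (m L : R) : (0 < m)%R ->
  (forall p, exponents a b p -> m <= psi p)%R -> (2 `^ fine b^-1 < L)%R ->
  \forall s \near 0^'+, weighted_power_sup (2 * s) <= L%:E * weighted_power_sup s.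
Proof.
move=> m0 mpsi bL; have L0 : (0 < L)%R := le_lt_trans (powR_ge0 _ _) bL.
have ln2 : (0 < ln (2 : R))%R by rewrite ln_gt0//; lra.
have [p pab pL] : exists2 p, exponents a b p & (2 `^ p^-1 < L)%R.
  have [|p pab pL] := @exponents_near_right _ a b a1 ab (ln L / ln 2)%R.
    by rewrite ltr_pdivlMr// -ln_powR ltr_ln ?posrE// powR_gt0.
  exists p => //; rewrite -ltr_ln ?posrE ?powR_gt0// ln_powR.
  by rewrite -ltr_pdivlMr.
have [q qab pq] := exponents_gt a1 ab pab.
have p0 := exponents_gt0 a1 pab; have q0 := exponents_gt0 a1 qab.
pose k := (p^-1 - q^-1)%R; have k0 : (0 < k)%R by rewrite subr_gt0 ltf_pV2.
(* the threshold making the term at q larger than s^(1/p) / m is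
   (m / psi q)^(1/k) with k = 1/p - 1/q *)
near=> s; have s0 : (0 < s)%R by [].
have s12 : (s <= 1 / 2)%R by near: s; apply: nbhs_right_ltW; lra.
have sk : (s `^ k <= m / psi q)%R.
  have sM : (s <= (m / psi q) `^ k^-1)%R.
    by near: s; apply: nbhs_right_ltW; rewrite powR_gt0 ?divr_gt0 ?psi0.
  have -> : (m / psi q = ((m / psi q) `^ k^-1) `^ k)%R.
    by rewrite -powRrM mulVf ?gt_eqF// powRr1 ?divr_ge0 ?ltW ?psi0.
  by rewrite ge0_ler_powR ?nnegrE ?powR_ge0 ?(ltW k0) ?(ltW s0).
have sp : (s `^ p^-1 / m)%:E <= weighted_power_sup s.
  apply: le_trans (weighted_power_sup_ge s qab); rewrite lee_fin.
  rewrite ler_pdivrMr// mulrAC ler_pdivlMr ?psi0//.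
  have -> : (p^-1 = q^-1 + k)%R by rewrite /k; ring.
  rewrite powRD; last by apply/implyP => _; rewrite gt_eqF.
  rewrite -mulrA ler_wpM2l ?powR_ge0//.
  by rewrite -ler_pdivlMr ?psi0.
apply: ge_ereal_sup => _ [r rab <-]; have r0 := exponents_gt0 a1 rab.
have [pr|/ltW rp] := leP p r.
- apply: (@le_trans _ _ (L%:E * (s `^ r^-1 / psi r)%:E)); last first.
    by rewrite lee_pmul2l ?lte_fin// weighted_power_sup_ge.
  rewrite -EFinM lee_fin mulrA ler_pM2r ?invr_gt0 ?psi0//.
  rewrite powRM ?(ltW s0)// ler_pM2r ?powR_gt0//; apply: le_trans (ltW pL).
  by rewrite ler_powR ?lef_pV2 ?posrE//; lra.
- apply: (@le_trans _ _ (L%:E * (s `^ p^-1 / m)%:E)); last first.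
    by rewrite lee_pmul2l ?lte_fin.
  rewrite -EFinM lee_fin mulrA.
  apply: (@le_trans _ _ ((2 * s) `^ p^-1 / m)%R); last first.
    by rewrite ler_pM2r ?invr_gt0// powRM ?(ltW s0)// ler_pM2r ?powR_gt0 ?(ltW pL).
  apply: ler_pM; rewrite ?powR_ge0 ?invr_ge0 ?(ltW (psi0 rab))//.
  + rewrite ger_powR ?lef_pV2 ?posrE//; lra.
  + by rewrite lef_pV2 ?posrE ?mpsi ?psi0.
Unshelve. all: by end_near. Qed.

Lemma weighted_power_sup_double_ge (s : R) : (0 <= s)%R ->
  (2 `^ fine b^-1)%:E * weighted_power_sup s <= weighted_power_sup (2 * s).
Proof.
move=> s0; rewrite -lee_pdivlMl ?powR_gt0//.
apply: ge_ereal_sup => _ [p pab <-]; rewrite lee_pdivlMl ?powR_gt0//.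
apply: le_trans (weighted_power_sup_ge _ pab).
rewrite -EFinM lee_fin mulrA ler_pM2r ?invr_gt0 ?psi0// powRM//.
rewrite ler_wpM2r ?powR_ge0// ler_powR//; first by lra.
exact/ltW/(exponents_inve_lt a1 pab).
Qed.

End fundamental.

(** * Lower bound for admissible weights *)

Section lower_bound.
Context (R : realType) (a : R) (b : \bar R).
Hypothesis ab : a%:E < b.

Lemma near_at_right_exponents (P : set R) : (\forall p \near a^'+, P p) ->
  exists2 q, exponents a b q & forall p, (a < p <= q)%R -> P p.
Proof.
move=> /nbhs_ballP[e /= e0 eP].
have [q [aq qb qe]] : exists q, [/\ (a < q)%R, q%:E < b & (q < a + e)%R].
  case: b ab => [r||//].
  - rewrite lte_fin => ar; exists ((a + Num.min r (a + e)) / 2)%R; rewrite lte_fin.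
    by split; case: (leP r (a + e)%R) => ?; lra.
  - by exists (a + e / 2)%R; rewrite ltry; split => //; lra.
exists q; first exact/andP.
move=> p /andP[ap pq]; apply: eP => //=.
by rewrite /ball/= ltr_norml; apply/andP; split; lra.
Qed.

Lemma near_left_of_exponents (P : set R) : (\forall p \near left_of b, P p) ->
  exists2 q, exponents a b q & forall p, (q <= p)%R -> p%:E < b -> P p.
Proof.
rewrite /left_of /exponents; case: b ab => [r||//].
- rewrite lte_fin => ar /nbhs_ballP[e /= e0 eP].
  exists (Num.max ((a + r) / 2) (r - e / 2))%R.
    by rewrite /= !lte_fin; case: (leP ((a + r) / 2)%R (r - e / 2)%R) => ?;
      apply/andP; split; lra.
  move=> p; rewrite ge_max => /andP[p1 p2]; rewrite lte_fin => pr.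
  apply: eP => //=; rewrite /ball/= ltr_norml; apply/andP; split; lra.
- move=> _ [M [_ MP]]; exists (Num.max (a + 1) (M + 1))%R.
    by rewrite /= ltry andbT lte_fin lt_max; apply/orP; left; lra.
  by move=> p; rewrite ge_max => /andP[_ Mp] _; apply: MP; lra.
Qed.

Lemma cvg_gt0_lower_bound (F : set_system R) (psi : R -> R) (l : \bar R) :
  Filter F ->
  (psi p)%:E @[p --> F] --> l -> 0 < l ->
  exists2 m, (0 < m)%R & \forall p \near F, (m <= psi p)%R.
Proof.
move=> FF psil l0.
have [m m0 ml] : exists2 m, (0 < m)%R & m%:E < l.
  case: l l0 {psil} => [r||//]; last by exists 1%R => //; rewrite ltry.
  by rewrite lte_fin => r0; exists (r / 2)%R; rewrite ?lte_fin; lra.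
exists m => //.
have : F [set p | m%:E < (psi p)%:E] := psil _ (open_ereal_gt' ml).
by apply: filterS => p /=; rewrite lte_fin => /ltW.
Qed.

(** The limits bound the weight below near both ends; in between, the extreme value
theorem applies to the compact interval [u, v]. *)
Lemma admissible_weight_lower_bound psi : admissible_weight a b psi ->
  exists2 m, (0 < m)%R & forall p, exponents a b p -> (m <= psi p)%R.
Proof.
move=> [psi0 cpsi _ [la [lb [psila psilb _]]]]; rewrite lt_min => /andP[la0 lb0].
have [m1 m10 /near_at_right_exponents[u uab um1]] := cvg_gt0_lower_bound _ psila la0.
have lbF : Filter (left_of b) by rewrite /left_of; case: b => *; exact: _.
have [m2 m20 /near_left_of_exponents[v vab vm2]] := cvg_gt0_lower_bound _ psilb lb0.
have [au ub] := andP uab; have [av vb] := andP vab.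
have [m3 m30 mid] : exists2 m, (0 < m)%R &
    forall p, (u <= p <= v)%R -> (m <= psi p)%R.
  (* if v < u the two neighbourhoods of the ends already cover (a, b) *)
  have [uv|vu] := leP u v; last first.
    by exists 1%R => // p /andP[up pv];
      move: (lt_le_trans vu (le_trans up pv)); rewrite ltxx.
  have sub : `[u, v]%classic `<=` exponents a b.
    move=> p /=; rewrite in_itv/= => /andP[up pv]; apply/andP; split.
    - by apply: (lt_le_trans au); rewrite lee_fin.
    - by apply: (le_lt_trans _ vb); rewrite lee_fin.
  have [|c cuv cmin] := @EVT_min _ psi u v uv.
    by apply: continuous_subspaceW sub _; exact: continuous_in_subspaceT.
  exists (psi c); first by apply: psi0; rewrite inE; exact: sub.
  by move=> p puv; apply: cmin; rewrite in_itv.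
exists (Num.min m1 (Num.min m2 m3)).
  by rewrite !lt_min m10 m20.
move=> p /andP[ap pb]; rewrite !ge_min.
have [pu|/ltW up] := leP p u; first by rewrite um1 ?pu ?andbT// -lte_fin.
have [pv|/ltW vp] := leP p v; first by rewrite mid ?up// !orbT.
by rewrite vm2 ?orbT.
Qed.

End lower_bound.

(** * Doubling ratio and conclusion *)

(** Small s is needed three times: below half the measure of a set of finite
measure, so that both s and 2 s are approximable; below 1, so that phi(s) is
finite and the quotient makes sense; and for the upper estimate. *)
Lemma doubling_ratio_bounds (R : realType) d (X : measurableType d)
    (mu : {measure set X -> \bar R}) (a : R) (b : \bar R) (psi : R -> R) (L : R) :
  nontrivial_measure mu -> sigma_finite setT mu -> diffuse mu ->
  (1 <= a)%R -> a%:E < b -> admissible_weight a b psi ->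
  (2 `^ fine b^-1 < L)%R ->
  \forall s \near 0^'+,
    (2 `^ fine b^-1)%:E <= doubling_ratio mu psi a b s <= L%:E.
Proof.
move=> mu0 smu dmu a1 ab wpsi bL.
have psi0 p : exponents a b p -> (0 < psi p)%R.
  by case: wpsi => + _ _ _ => psi0 pab; rewrite psi0 ?inE.
have [m m0 mpsi] := admissible_weight_lower_bound ab wpsi.
have [A [t [mA t0 muA]]] := sigma_finite_nontrivial mu0 smu.
have ub := weighted_power_sup_double_le a1 ab psi0 m0 mpsi bL.
near=> s; have s0 : (0 < s)%R by [].
have s1 : (s <= 1)%R by near: s; apply: nbhs_right_ltW.
have st : (s <= t / 2)%R by near: s; apply: nbhs_right_ltW; lra.
rewrite /doubling_ratio !(fundamental_functionE a1 psi0 dmu mA muA t0); last 2 first.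
- by apply/andP; split; lra.
- by apply/andP; split; lra.
have := weighted_power_sup_gt0 a1 ab psi0 s0.
have := weighted_power_sup_lty a1 psi0 m0 mpsi (s := s).
rewrite s1 (ltW s0) => /(_ isT).
have : weighted_power_sup a b psi (2 * s) <= L%:E * weighted_power_sup a b psi s.
  by near: s; exact: ub.
have := weighted_power_sup_double_ge a1 psi0 (ltW s0).
case: (weighted_power_sup a b psi s) => [c|//|//] lo up _; rewrite lte_fin => c0.
by rewrite inver gt_eqF// lee_pdivlMr// lo lee_pdivrMr.
Unshelve. all: by end_near. Qed.

Theorem theorem2 (R : realType) :
  (forall (a : R) (b : \bar R) (psi : R -> R),
     (1 <= a)%R -> a%:E < b ->
     Psi (@halfline_lebesgue R) a b psi ->
     [/\ cvg (dilation_exponent psi a b s @[s --> 0^'+]),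
         dilation_index1 psi a b = b^-1,
         cvg (dilation_exponent psi a b s @[s --> +oo%R]) &
         dilation_index2 psi a b = (a^-1)%:E])
  /\
  (forall (d : measure_display) (X : measurableType d)
     (mu : {measure set X -> \bar R}) (a : R) (b : \bar R) (psi : R -> R),
     nontrivial_measure mu -> sigma_finite setT mu -> diffuse mu ->
     (1 <= a)%R -> a%:E < b ->
     admissible_weight a b psi ->
     fundamental_index1 mu psi a b = (2 `^ fine (b^-1)%E)%:E /\
     fundamental_index2 mu psi a b = (2 `^ fine (b^-1)%E)%:E).
Proof.
split=> [a b psi a1 ab Psi_psi|d X mu a b psi mu0 smu dmu a1 ab wpsi].
- have cvg0 : dilation_exponent psi a b s @[s --> 0^'+] --> b^-1.
    apply: cvg_near_cst; near=> s; apply: dilation_exponent_lt1 => //.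
    by apply/andP; split => //; near: s; exact: nbhs_right_lt.
  have cvgy : dilation_exponent psi a b s @[s --> +oo%R] --> (a^-1)%:E.
    apply: cvg_near_cst; apply: filterS (nbhs_pinfty_gt (num_real 1%R)) => s.
    exact: dilation_exponent_gt1.
  by split; [exact: cvgP cvg0|exact: cvg_lim cvg0|
             exact: cvgP cvgy|exact: cvg_lim cvgy].
- have bounds L := doubling_ratio_bounds mu0 smu dmu a1 ab wpsi (L := L).
  have le1 : (2 `^ fine b^-1)%:E <= fundamental_index1 mu psi a b.
    apply: limf_einf_ge; apply: filterS (bounds (2 `^ fine b^-1 + 1)%R _).
      by move=> s /andP[].
    by rewrite ltrDl.
  have le12 : fundamental_index1 mu psi a b <= fundamental_index2 mu psi a b.
    exact: limf_einf_le_esup.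
  have le2 : fundamental_index2 mu psi a b <= (2 `^ fine b^-1)%:E.
    apply/lee_addgt0Pr => e e0; rewrite -EFinD.
    apply: limf_esup_le; apply: filterS (bounds (2 `^ fine b^-1 + e)%R _).
      by move=> s /andP[].
    by rewrite ltrDl.
  split; apply/eqP; rewrite eq_le.
  + by rewrite le1 (le_trans le12 le2).
  + by rewrite le2 (le_trans le1 le12).
Unshelve. all: by end_near. Qed.
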